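(* Let $t$ be a positive integer such that $4t+1=p^2$ for a prime $p$. Let $X=\begin{pmatrix} R_1 & R_2\\ -R_2^\top & R_1^\top\end{pmatrix}$ be an EW matrix of order $4t+2$, where $R_1,R_2$ are $(2t+1)\times(2t+1)$ matrices, and suppose there are integers $r_1,r_2$ with $R_1J=R_1^\top J=r_1J$ and $R_2J=R_2^\top J=r_2J$ ($J$ the $(2t+1)\times(2t+1)$ all-ones matrix). Let $x_1,\ldots,x_{4t+2}$ be the invariant factors of $X$. Then: (i) $\gcd(r_1,r_2)$ is $1$ or $p$; (ii) $x_{4t+2}$ is $2t(4t+1)$ or $2tp$; (iii) if $x_{4t+2}=2t(4t+1)$ then $x_{4t+1}$ divides $2t$; if $x_{4t+2}=2tp$ then $x_{4t+1}$ divides $2tp$ and $p$ divides $x_{4t+1}$; (iv) if $t$ is square-free, then the Smith normal form of $X$ is either \[ \operatorname{diag}[1,\underbrace{2,\dots,2}_{2t+1},\underbrace{2t,\dots,2t}_{2t-1},2t(4t+1)]\quad\text{or}\quad \operatorname{diag}[1,\underbrace{2,\dots,2}_{2t+1},\underbrace{2t,\dots,2t}_{2t-2},2tp,2tp]. \]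
   Context: For $n\equiv 2\pmod 4$, a $\{1,-1\}$-matrix $B$ of order $n$ is called an EW matrix if \[ BB^\top=B^\top B=\begin{pmatrix}(n-2)I_{n/2}+2J_{n/2} & O\\ O & (n-2)I_{n/2}+2J_{n/2}\end{pmatrix}, \] where $I$ is the identity matrix, $J$ the all-ones matrix and $O$ the zero matrix. Every $n\times n$ integer matrix $M$ is equivalent (via $M\mapsto PMQ$ with $P,Q$ unimodular integer matrices) to a unique diagonal matrix $\operatorname{diag}[m_1,\dots,m_n]$ with nonnegative integers $m_i$, $m_i\mid m_{i+1}$; this is the Smith normal form of $M$ and the $m_i$ are its invariant factors. *)

(* Defs.v *)
From mathcomp Require Import all_boot all_order all_algebra.

Set Implicit Arguments.
Unset Strict Implicit.
Unset Printing Implicit Defensive.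

Import Order.TTheory GRing.Theory Num.Theory.
Local Open Scope ring_scope.

Definition allones (n : nat) : 'M[int]_n := const_mx 1.

(* An EW matrix of order n = h + h, so that h = n / 2. *)
Definition EW_matrix (h : nat) (B : 'M[int]_(h + h)) : Prop :=
  let n := (h + h)%N in
  let D : 'M[int]_h := (n%:Z - 2)%:M + 2 *: allones h in
  [/\ (n = 2 %[mod 4])%N,
      forall i j, B i j = 1 \/ B i j = -1,
      B *m B^T = block_mx D 0 0 D
    & B^T *m B = block_mx D 0 0 D].

(* [:: m_1; ...; m_n] is the list of invariant factors of M, i.e. the diagonal
   of its Smith normal form; m_i is [nth 0 d i.-1]. For int matrices, unitmx
   means unimodular, and the coefficients are nonnegative because they are in
   nat. Divisibility of consecutive terms allows trailing zeros. *)
Definition smith_normal_form (n : nat) (M : 'M[int]_n) (d : seq nat) : Prop :=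
  [/\ size d = n,
      sorted dvdn d
    & exists P Q : 'M[int]_n,
        [/\ P \in unitmx, Q \in unitmx
          & P *m M *m Q = diag_mx (\row_(i < n) (nth 0%N d i)%:Z)]].

Definition squarefree (n : nat) : Prop :=
  forall d : nat, (d ^ 2 %| n)%N -> d = 1%N.

(* Main.v *)
Require Import Defs.
From mathcomp Require Import all_boot all_order all_algebra.
From mathcomp Require Import ring zify.

Import Order.TTheory GRing.Theory Num.Theory.
Local Open Scope ring_scope.

(* Multiplying X X^T by J gives r1^2 + r2^2 = 2 p^2, whence gcd(r1, r2) is 1 or
   p.  Writing K for the block matrix [r1 J, -r2 J; r2 J, r1 J], one has
   X (p^2 X^T - K) = 4 t p^2 I.  The entries of p^2 X^T - K are +-p^2 +- r_i, and
   their gcd is 2 gcd(r1, r2), so the last invariant factor of X is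
   2 t p^2 / gcd(r1, r2).  Since det X = +-2 (4t)^(2t) p^2 and p does not divide
   4t, exactly two factors p are distributed over the invariant factors, which
   settles the next to last one.  Modulo 2, X has rank 1, so every invariant
   factor but the first is even; if t is square-free, each prime q dividing t
   divides each half x_i / 2 at most once (as x_i / 2 divides t p^2) and 2t of
   them in total, hence exactly the last 2t. *)

(** * Divisibility of matrix entries, and the determinant of [a I + b J] *)

Lemma dvdz_mulmx m n k l (c : int) (P : 'M[int]_(m, n)) (M : 'M[int]_(n, k))
    (Q : 'M[int]_(k, l)) :
  (forall i j, (c %| M i j)%Z) -> forall i j, (c %| (P *m M *m Q) i j)%Z.
Proof.
move=> cM i j; rewrite mxE; apply: rpred_sum => a _; apply: dvdz_mulr.
by rewrite mxE; apply: rpred_sum => b _; apply: dvdz_mull.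
Qed.

(** The bordered matrix [N] is triangularised from the left by a multiplier of determinant 1 and
    from the right by one of determinant [a]. Keeping the factor [a] avoids a division. *)
Lemma det_scalar_add_allones (R : comNzRingType) n (a b : R) :
  \det (a%:M + b *: const_mx 1 : 'M_n) * a = (a + n%:R * b) * a ^+ n.
Proof.
pose u : 'cV[R]_n := const_mx 1; pose v : 'rV[R]_n := const_mx 1.
have uv : u *m v = const_mx 1.
  by apply/matrixP=> i j; rewrite !mxE big_ord1 !mxE mulr1.
have vu : v *m u = n%:R%:M.
  apply/matrixP=> i j; rewrite !mxE !ord1 eqxx mulr1n.
  under eq_bigr do rewrite !mxE mulr1.
  by rewrite sumr_const card_ord.
pose N : 'M[R]_(1 + n) := block_mx 1%:M (- (b *: v)) u a%:M.
have EL : block_mx 1%:M 0 (- u) 1%:M *m N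
    = block_mx 1%:M (- (b *: v)) 0 (a%:M + b *: const_mx 1).
  rewrite mulmx_block !mul1mx !mul0mx !addr0 mulmx1 addNr mulmxN mulNmx opprK.
  by rewrite -scalemxAr uv addrC.
have ER : N *m block_mx a%:M 0 (- u) 1%:M
    = block_mx (a + n%:R * b)%:M (- (b *: v)) 0 a%:M.
  rewrite mulmx_block !mulmx0 !mulmx1 !mul1mx !add0r mulmxN mulNmx opprK.
  rewrite -scalemxAl vu mul_scalar_mx mul_mx_scalar scalerN subrr.
  by rewrite scale_scalar_mx -raddfD /= [b * _]mulrC.
have := congr1 determinant EL; have := congr1 determinant ER.
rewrite !det_mulmx !det_lblock !det_ublock !det_scalar !expr1n !expr1 !mul1r !mulr1.
by move=> <- ->.
Qed.

Lemma sorted_dvdn_nth {d : seq nat} {i j : nat} :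
  sorted dvdn d -> (i <= j < size d)%N -> (nth 0 d i %| nth 0 d j)%N.
Proof.
move=> ds /andP[ij jd]; apply: (sorted_leq_nth dvdn_trans dvdnn) => //.
by rewrite inE (leq_ltn_trans ij jd).
Qed.

(** * Entries, cofactors and determinant read off a Smith normal form *)

Section SmithNormalForm.
Variables (n : nat) (M : 'M[int]_n) (d : seq nat).
Hypothesis snf : smith_normal_form M d.

(** With [D = P M Q], the product [D (invmx Q *m Y *m invmx P)] is [e I], and [c] still divides the
    entries of the second factor; compare diagonal entries. *)
Lemma smith_dvd_entries (c : int) (Y : 'M[int]_n) (e : int) (i : nat) :
    (forall i j, (c %| Y i j)%Z) -> M *m Y = e%:M -> (i < n)%N ->
  ((nth 0%N d i)%:Z * c %| e)%Z.
Proof.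
case: snf => _ _ [P [Q [uP uQ E]]] cY MY ltin.
set D := diag_mx _ in E.
have DW : D *m (invmx Q *m Y *m invmx P) = e%:M.
  by rewrite -E !mulmxA mulmxK // -(mulmxA P) MY mul_mx_scalar -scalemxAl mulmxV // scalemx1.
move/matrixP/(_ (Ordinal ltin) (Ordinal ltin)): DW.
rewrite mul_diag_mx mxE [_%:M _ _]mxE eqxx mulr1n [(\row_i _) _ _]mxE => <-.
by rewrite dvdz_mul // dvdz_mulmx.
Qed.

Lemma smith_first_dvd i j : (0 < n)%N -> ((nth 0%N d 0)%:Z %| M i j)%Z.
Proof.
case: snf => sd ds [P [Q [uP uQ E]]] n0.
set D := diag_mx _ in E.
have -> : M = invmx P *m D *m invmx Q.
  by rewrite -E !mulmxA mulVmx // mul1mx mulmxK.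
apply: dvdz_mulmx => a b; rewrite !mxE; case: eqP => _; last by rewrite mulr0n dvdz0.
rewrite mulr1n dvdzE !absz_nat.
by apply: sorted_dvdn_nth => //; rewrite sd ltn_ord.
Qed.

(** The witness is [Q F P], where [F] holds the quotients of the last factor by each factor. If also
    [M Y = e I], then [e] divides the last factor times each entry of [Y], which bounds the last
    factor from below. *)
Lemma smith_last_cofactor : (0 < n)%N -> (forall i, (i < n)%N -> (0 < nth 0%N d i)%N) ->
  exists Z : 'M[int]_n, Z *m M = (nth 0%N d n.-1)%:Z%:M.
Proof.
case: snf => sd ds [P [Q [uP uQ E]]] n0 dpos.
set D := diag_mx _ in E.
pose F : 'M[int]_n := diag_mx (\row_i (nth 0 d n.-1 %/ nth 0 d i)%N%:Z).
have FD : F *m D = (nth 0%N d n.-1)%:Z%:M.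
  rewrite mulmx_diag; apply/matrixP => i j; rewrite !mxE; congr (_ *+ _).
  by rewrite -PoszM divnK // sorted_dvdn_nth // sd prednK // leqnn andbT -ltnS prednK.
exists (Q *m F *m P).
have PM : P *m M = D *m invmx Q by rewrite -E mulmxK.
by rewrite -mulmxA PM mulmxA -(mulmxA Q) FD mul_mx_scalar -scalemxAl mulmxV // scalemx1.
Qed.

Lemma smith_det : `|\det M|%N = (\prod_(i < n) nth 0 d i)%N.
Proof.
case: snf => _ _ [P [Q [uP uQ E]]].
have absu (A : 'M[int]_n) : A \in unitmx -> `|\det A|%N = 1%N.
  by rewrite unitmxE => /orP[] /eqP ->.
have := congr1 (fun A => `|\det A|%N) E.
rewrite /= !det_mulmx !abszM (absu _ uP) (absu _ uQ) mul1n muln1 det_diag => ->.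
by elim/big_ind2: _ => // [a b c e <- <-|i _]; rewrite ?abszM // mxE.
Qed.

(* Modulo 2 the matrix is the all-ones matrix, which has rank 1. *)
Lemma smith_even i : (0 < i < n)%N -> (forall i j, ~~ (2 %| M i j)%Z) ->
  (2 %| nth 0%N d 0 * nth 0%N d i)%N.
Proof.
case: snf => _ _ [P [Q [uP uQ E]]] /andP[i0 ltin] Modd.
pose u : 'cV[int]_n := const_mx 1; pose v : 'rV[int]_n := const_mx 1.
have H a b : (2 %| (P *m M *m Q) a b - (P *m u) a ord0 * (v *m Q) ord0 b)%Z.
  have -> : (P *m M *m Q) a b - (P *m u) a ord0 * (v *m Q) ord0 b =
     (P *m (M - u *m v) *m Q) a b.
    rewrite mulmxBr mulmxBl [RHS]mxE [X in _ = _ + X]mxE; congr (_ - _).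
    by rewrite !mulmxA -(mulmxA _ v) [RHS]mxE big_ord1.
  apply: dvdz_mulmx => x y; rewrite !mxE big_ord1 !mxE mulr1.
  by move: (M x y) (Modd x y) => m; lia.
pose a0 := Ordinal (ltn_trans i0 ltin); pose ai := Ordinal ltin.
have n0i : (a0 == ai) = false by apply/eqP => /(congr1 val) /=; lia.
have ni0 : (ai == a0) = false by rewrite eq_sym.
move: (H a0 a0) (H ai ai) (H a0 ai) (H ai a0).
rewrite E !mxE !eqxx n0i ni0 /= !mulr0n !mulr1n.
move: (nth 0%N d 0) (nth 0%N d i) => A B.
move: (\sum_j _ : int) (\sum_j _ : int) (\sum_j _ : int) (\sum_j _ : int).
move=> b' a' b a /dvdzP[x Ex] /dvdzP[y Ey] /dvdzP[z Ez] /dvdzP[w Ew].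
suff : (2 %| A%:Z * B%:Z)%Z by [].
(* The 2 by 2 minor of [D] at positions [0] and [i] is compared with the minor of a rank-one matrix,
   which vanishes. *)
apply/dvdzP; exists (x * B%:Z + a * b * y - a * b' * w).
have -> : A%:Z * B%:Z = (A%:Z - a * b) * B%:Z + a * b * (B%:Z - a' * b')
   - a * b' * (0 - a' * b) by ring.
by rewrite Ex Ey Ew; ring.
Qed.
End SmithNormalForm.

(** * Distribution of the primes of [t] along a divisor chain *)

(** A zero at [i] forces zeros before it, so [k] is at most [m - i - 1]; a one at [i] forces ones
    after it, so [k] is at least [m - i]. *)
Lemma binary_tail {f : nat -> nat} {m k : nat} :
  {in gtn m, forall i, f i <= 1}%N -> {in gtn m &, {homo f : i j / (i <= j)%N}} ->
  (\sum_(i < m) f i)%N = k -> {in gtn m, forall i, f i = (m - k <= i)}%N.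
Proof.
move=> f1 fmono fk i im; have ltim : (i < m)%N := im.
have split_sum : (\sum_(0 <= j < i) f j + \sum_(i <= j < m) f j = k)%N.
  by rewrite -big_cat_nat ?big_mkord //= ltnW.
case: (posnP (f i)) => [fi0 | fi_pos].
  have lo : (\sum_(0 <= j < i) f j = 0)%N.
    rewrite big_nat big1 // => j /andP[_ ji]; apply/eqP.
    by rewrite -leqn0 -fi0 fmono ?inE ?(ltn_trans ji) // ltnW.
  have hi : (\sum_(i.+1 <= j < m) f j <= m - i.+1)%N.
    rewrite -[(m - _)%N]muln1 -sum_nat_const_nat big_nat [leqRHS]big_nat.
    by apply: leq_sum => j /andP[_ /f1].
  move: split_sum; rewrite lo big_ltn // fi0; lia.
have hi : (m - i <= \sum_(i <= j < m) f j)%N.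
  rewrite -[(m - _)%N]muln1 -sum_nat_const_nat big_nat [leqRHS]big_nat.
  by apply: leq_sum => j /andP[ij jm]; rewrite (leq_trans fi_pos) ?fmono.
have := f1 _ im; lia.
Qed.

Lemma logn_squarefree {t q : nat} : (0 < t)%N -> squarefree t -> prime q -> (q %| t)%N ->
  logn q t = 1%N.
Proof.
move=> t0 sqf q_pr qt; apply/eqP; rewrite eqn_leq leqNgt -!pfactor_dvdn // expn1 qt andbT.
by apply/negP => /sqf q1; rewrite q1 in q_pr.
Qed.

Lemma squarefree_dvd {t m : nat} : (0 < t)%N -> squarefree t ->
  (forall q, prime q -> q %| t -> q %| m)%N -> (t %| m)%N.
Proof.
move=> t0 sqf H; apply/dvdn_partP => // q.
rewrite mem_primes => /and3P[q_pr _ qt].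
by rewrite p_part (logn_squarefree t0 sqf) // expn1 H.
Qed.

Lemma logn_prod q m {z : nat -> nat} : (forall i, (i < m)%N -> (0 < z i)%N) ->
  logn q (\prod_(i < m) z i) = (\sum_(i < m) logn q (z i))%N.
Proof.
elim: m => [|m IH] z0; first by rewrite !big_ord0 logn1.
have z0' i : (i < m)%N -> (0 < z i)%N by move=> im; rewrite z0 // ltnS ltnW.
rewrite !big_ord_recr /= lognM ?z0 ?IH //.
by apply: prodn_gt0 => i; rewrite z0'.
Qed.

(** For a prime [q] dividing [t], the [q]-valuations of the [z i] are at most 1, since [q] divides
    [t] once and is prime to [c]; they are nondecreasing and add up to [k]. By [binary_tail] the cut
    is at [m - k] for every such [q], hence for [t] as a whole. *)
Lemma dvdn_chain_split {t c m k : nat} {z : nat -> nat} :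
  (0 < t)%N -> squarefree t -> coprime c t ->
  {in gtn m &, forall i j, (i <= j)%N -> (z i %| z j)%N} ->
  {in gtn m, forall i, (z i %| t * c)%N} ->
  (\prod_(i < m) z i = t ^ k * c)%N -> (0 < c)%N ->
  {in gtn m, forall i, if (m - k <= i)%N then (t %| z i)%N else coprime (z i) t}.
Proof.
move=> t0 sqf ct zd ztc zk c0.
have z0 i : (i < m)%N -> (0 < z i)%N.
  by move=> im; apply: dvdn_gt0 (ztc i im); rewrite muln_gt0 t0.
have key q : prime q -> (q %| t)%N -> {in gtn m, forall i, logn q (z i) = (m - k <= i)%N}.
  move=> q_pr qt; have lt1 := logn_squarefree t0 sqf q_pr qt.
  have lc0 : logn q c = 0%N.
    by rewrite logn_coprime // (coprime_dvdl qt) // coprime_sym.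
  apply: binary_tail => [i im | i j im jm ij|].
  - by rewrite -lt1 -[logn q t]addn0 -lc0 -lognM // dvdn_leq_log ?muln_gt0 ?t0 ?ztc.
  - by rewrite dvdn_leq_log ?z0 ?zd.
  - have -> : (k = logn q (\prod_(i < m) z i))%N.
      by rewrite zk lognM ?expn_gt0 ?t0 // lognX lt1 lc0 muln1 addn0.
    by rewrite logn_prod.
move=> i im; have iltm : (i < m)%N := im.
have key' q : prime q -> (q %| t)%N -> (q %| z i)%N = (m - k <= i)%N.
  move=> q_pr qt; have := key q q_pr qt i im.
  by have := logn_gt0 q (z i); rewrite mem_primes q_pr z0 //= => <- ->; rewrite lt0b.
case: ifPn => kmi.
  by apply: squarefree_dvd => // q q_pr qt; rewrite key'.
rewrite coprime_has_primes ?z0 //; apply/hasPn => q.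
rewrite !mem_primes t0 z0 //= => /andP[q_pr qt].
by rewrite q_pr key' // (negPf kmi).
Qed.

(** * EW matrices with constant block sums: Gram matrix, cofactor, determinant *)

Section RegularEW.
Variables (h : nat) (R1 R2 : 'M[int]_h) (r1 r2 : int).
Let J := allones h.
Let X : 'M[int]_(h + h) := block_mx R1 R2 (- R2^T) R1^T.
Hypotheses (h0 : (0 < h)%N) (ewX : EW_matrix X).
Hypotheses (R1J : R1 *m J = r1 *: J) (R1TJ : R1^T *m J = r1 *: J).
Hypotheses (R2J : R2 *m J = r2 *: J) (R2TJ : R2^T *m J = r2 *: J).
(** The order minus one, equal to [p ^ 2] in the theorem; thus [s - 1 + 2 h = 2 s]. *)
Let s : int := (h + h)%N%:Z - 1.
Let D : 'M[int]_h := (s - 1)%:M + 2 *: J.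
Let K : 'M[int]_(h + h) := block_mx (r1 *: J) (- (r2 *: J)) (r2 *: J) (r1 *: J).

Lemma EW_gram : X *m X^T = block_mx D 0 0 D.
Proof.
case: ewX => _ _ -> _; rewrite /D /s -addrA; congr (block_mx (_%:M + _) _ _ (_%:M + _)).
Qed.

Lemma EW_sum_squares : r1 ^+ 2 + r2 ^+ 2 = 2 * s.
Proof.
have JJ : J *m J = h%:R *: J.
  apply/matrixP=> i j; rewrite !mxE; under eq_bigr do rewrite !mxE mulr1.
  by rewrite sumr_const card_ord mulr1.
have := EW_gram; rewrite /X tr_block_mx mulmx_block => /eq_block_mx[E _ _ _].
have := congr1 (mulmx^~ J) E; rewrite /D !mulmxDl -!mulmxA R1TJ R2TJ.
rewrite -!scalemxAr R1J R2J mul_scalar_mx -scalemxAl JJ.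
move/matrixP/(_ (Ordinal h0) (Ordinal h0)); rewrite !mxE !mulr1.
by rewrite /s; lia.
Qed.

(** The diagonal blocks of [X K] are [(r1 ^+ 2 + r2 ^+ 2) J = 2 s J], and the mixed terms in [r1 r2]
    cancel; this removes the [J] part of [s X X^T]. *)
Lemma EW_mul_cofactor : X *m (s *: X^T - K) = (s * (s - 1))%:M.
Proof.
rewrite mulmxBr -scalemxAr EW_gram /X /K mulmx_block !mulmxN !mulNmx.
rewrite -!scalemxAr R1J R2J R1TJ R2TJ !scalerA.
rewrite [r2 * r1]mulrC addNr opprK -!scalerDl -!expr2.
rewrite [r2 ^+ 2 + _]addrC EW_sum_squares scale_block_mx !scaler0.
rewrite opp_block_mx add_block_mx !oppr0 !addr0 /D scalerDr scalerA [2 * s]mulrC addrK.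
by rewrite scale_scalar_mx -scalar_mx_block.
Qed.

(** The squares of [det X] and [det D] agree, and [det D] comes from [det_scalar_add_allones]. The
    factor [s - 1] is not cancelled, as it vanishes for [h = 1]. *)
Lemma EW_det : `|\det X|%N * `|(s - 1)%R|%N = (2 * `|s| * `|(s - 1)%R| ^ h)%N.
Proof.
have := congr1 determinant EW_gram; rewrite det_mulmx det_tr det_ublock => detX.
have -> : `|\det X|%N = `|\det D|%N.
  apply/eqP; rewrite -(eqn_exp2r _ _ (isT : 0 < 2)%N) !expnS !expn0 !muln1 -!abszM.
  by rewrite detX.
have := det_scalar_add_allones _ h (s - 1) 2; rewrite -/(allones h) -/J -/D.
move/(congr1 absz); rewrite /= !abszM abszX => E; rewrite [LHS]E.
by congr (_ * _)%N; rewrite natz /s; lia.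
Qed.

Lemma EW_entry i j : X i j = 1 \/ X i j = -1. Proof. by case: ewX. Qed.

Lemma EW_R1_entry i j : R1 i j = 1 \/ R1 i j = -1.
Proof. by rewrite -(block_mxEul R1 R2 (- R2^T) R1^T); apply: EW_entry. Qed.

Lemma EW_R2_entry i j : R2 i j = 1 \/ R2 i j = -1.
Proof. by rewrite -(block_mxEur R1 R2 (- R2^T) R1^T); apply: EW_entry. Qed.

End RegularEW.

(** * Parity, signs and common divisors of the row sums *)

(** All entries are odd, so [r] has the parity of the number [h] of summands. *)
Lemma odd_row_sum h (R : 'M[int]_h) (r : int) : odd h ->
    (forall i j, R i j = 1 \/ R i j = -1) -> R *m allones h = r *: allones h ->
  ~~ (2 %| r)%Z.
Proof.
case: h R => // h R h_odd Re RJ.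
move/matrixP/(_ ord0 ord0): RJ; rewrite !mxE mulr1.
under eq_bigr do rewrite !mxE mulr1.
move=> Er; have : (2 %| r - h.+1%:Z)%Z.
  have -> : h.+1%:Z = \sum_(j < h.+1) 1 by rewrite sumr_const card_ord natz.
  rewrite -Er -sumrB; apply: rpred_sum => j _.
  by case: (Re ord0 j) => ->.
by move: h_odd; lia.
Qed.

(* If all entries were equal, then [r] would be [h] or [-h]. *)
Lemma both_signs h (R : 'M[int]_h) (r : int) : (0 < h)%N ->
    (forall i j, R i j = 1 \/ R i j = -1) -> R *m allones h = r *: allones h ->
    r ^+ 2 < h%:Z ^+ 2 ->
  (exists i j, R i j = 1) /\ (exists i j, R i j = -1).
Proof.
move=> h0 Re RJ rh; pose i0 := Ordinal h0.
have const c : (forall i j, R i j = c) -> r = h%:Z * c.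
  move=> Rc; move/matrixP/(_ i0 i0): RJ; rewrite !mxE mulr1 => <-.
  under eq_bigr do rewrite Rc !mxE mulr1.
  by rewrite sumr_const card_ord -mulr_natl natz.
have found c : c ^+ 2 = 1 -> exists i j, R i j != c.
  move=> c2; case: (boolP [exists i, exists j, R i j != c]) => [/existsP[i /existsP[j Rij]]|].
    by exists i, j.
  move=> /existsPn allc; have rc : r = h%:Z * c.
    by apply: const => i j; move/existsPn/(_ j): (allc i); rewrite negbK => /eqP.
  by move: rh; rewrite rc exprMn c2 mulr1 ltxx.
split.
  have [//|i [j Rij]] := found (-1); exists i, j.
  by case: (Re i j) Rij => // ->.
have [//|i [j Rij]] := found 1; exists i, j.
by case: (Re i j) Rij => // ->.
Qed.

(** The gcd [g] is odd because [r1] is, so [g ^ 2] divides [p ^ 2] and [g] divides [p]. *)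
Lemma gcdz_sum_squares (p : nat) (r1 r2 : int) : prime p -> ~~ (2 %| r1)%Z ->
  r1 ^+ 2 + r2 ^+ 2 = 2 * p%:Z ^+ 2 -> gcdz r1 r2 = 1 \/ gcdz r1 r2 = p%:Z.
Proof.
move=> p_pr r1odd E; set g := gcdz r1 r2.
have gabs : g = `|g|%N by rewrite /g.
have godd : coprime (`|g| ^ 2) 2.
  rewrite coprimeXl // coprimen2; apply: contraNT r1odd; rewrite -dvdn2 => g2.
  exact: dvdz_trans (_ : (2 %| g)%Z) (dvdz_gcdl _ _).
have : (`|g| ^ 2 %| 2 * p ^ 2)%N.
  have : (g ^+ 2 %| 2 * p%:Z ^+ 2)%Z.
    rewrite -E; apply: rpredD; apply: dvdz_exp2r; [exact: dvdz_gcdl | exact: dvdz_gcdr].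
  by rewrite dvdzE abszX abszM abszX.
rewrite Gauss_dvdr // dvdn_pexp2r // => gp.
case/primeP: p_pr => _ /(_ _ gp) /orP[] /eqP gE; [left | right]; by rewrite gabs gE.
Qed.

(** * Exact value of the last invariant factor *)

Lemma dvdz2_signed_sub (s e r : int) : e = 1 \/ e = -1 -> ~~ (2 %| s)%Z -> ~~ (2 %| r)%Z ->
  (2 %| s * e - r)%Z.
Proof. by case=> ->; lia. Qed.

(** The two sides divide each other: [2 g] divides every entry of [Y = s X^T - K], and conversely
    combinations of entries of [Y] produce [2 r1] and [2 r2], hence [2 g]. *)
Lemma EW_last_factor h (R1 R2 : 'M[int]_h) (r1 r2 : int) (x : seq nat)
    (J := allones h) (X : 'M[int]_(h + h) := block_mx R1 R2 (- R2^T) R1^T)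
    (s := (h + h)%N%:Z - 1) :
    (3 < h)%N -> odd h -> EW_matrix X ->
    R1 *m J = r1 *: J -> R1^T *m J = r1 *: J ->
    R2 *m J = r2 *: J -> R2^T *m J = r2 *: J ->
    (gcdz r1 r2 %| s)%Z -> smith_normal_form X x ->
    (forall i, (i < h + h)%N -> (0 < nth 0 x i)%N) ->
  (nth 0%N x (h + h).-1)%:Z * (2 * gcdz r1 r2) = s * (s - 1).
Proof.
move=> h3 hodd ewX R1J R1TJ R2J R2TJ gs snf xpos.
have h0 : (0 < h)%N by apply: leq_trans h3.
have s1 : 1 <= s by rewrite /s; move: h3; clear; lia.
have n0 : (0 < h + h)%N by rewrite addn_gt0 h0.
have R1e := EW_R1_entry _ _ _ ewX; have R2e := EW_R2_entry _ _ _ ewX.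
have r1odd := odd_row_sum _ _ _ hodd R1e R1J; have r2odd := odd_row_sum _ _ _ hodd R2e R2J.
have sq := EW_sum_squares _ _ _ _ _ h0 ewX R1J R1TJ R2J R2TJ.
rewrite -/s in sq.
(* Here [r1 ^+ 2 <= 2 s = 4 h - 2 < h ^+ 2], as [h] is at least 4. *)
have [[i [j Rij]] [i' [j' Rij']]] : (exists i j, R1 i j = 1) /\ (exists i j, R1 i j = -1).
  apply: (both_signs _ _ _ h0 R1e R1J); have r2sq := sqr_ge0 r2.
  have : h%:Z ^+ 2 >= 4 * h%:Z by rewrite expr2 ler_wpM2r //; lia.
  by move: sq r2sq; rewrite /s; lia.
have sodd : ~~ (2 %| s)%Z by rewrite /s; clear; lia.
have := EW_mul_cofactor _ _ _ _ _ h0 ewX R1J R1TJ R2J R2TJ.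
rewrite -/X -/s -/J; set K := block_mx _ _ _ _; set Y := s *: X^T - K => XY.
have YE : Y = block_mx (s *: R1^T - r1 *: J) (r2 *: J - s *: R2) (s *: R2^T - r2 *: J)
   (s *: R1 - r1 *: J).
  rewrite /Y /X /K tr_block_mx linearN /= !trmxK scale_block_mx opp_block_mx add_block_mx.
  by rewrite scalerN opprK [- _ + _]addrC.
set g := gcdz r1 r2; set xn := nth _ _ _.
have gr1 : (g %| r1)%Z by apply: dvdz_gcdl.
have gr2 : (g %| r2)%Z by apply: dvdz_gcdr.
have godd : coprimez 2 g.
  rewrite coprimezE coprime2n; apply: contraNT r1odd; rewrite -dvdn2 => g2.
  exact: dvdz_trans (_ : (2 %| g)%Z) gr1.
have ub : (xn%:Z * (2 * g) %| s * (s - 1))%Z.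
  apply: (smith_dvd_entries _ _ _ snf _ _ _ _ _ XY); last by rewrite prednK.
  have cE (e r : int) : (e = 1 \/ e = -1) -> ~~ (2 %| r)%Z -> (g %| r)%Z ->
     (2 * g %| s * e - r)%Z.
    move=> ee rodd gr; rewrite Gauss_dvdz //; apply/andP; split; last first.
      by rewrite rpredB ?dvdz_mulr.
    exact: dvdz2_signed_sub.
  have cN (e r : int) : (e = 1 \/ e = -1) -> ~~ (2 %| r)%Z -> (g %| r)%Z ->
     (2 * g %| r - s * e)%Z.
    by move=> ee rodd gr; rewrite -opprB dvdzE abszN -dvdzE cE.
  move=> a b; rewrite YE.
  case: (split_ordP a) => a1 ->; case: (split_ordP b) => b1 ->;
    rewrite ?(block_mxEul, block_mxEur, block_mxEdl, block_mxEdr) !mxE mulr1;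
    by [apply: cE | apply: cN].
have [Z ZX] := smith_last_cofactor _ _ _ snf n0 xpos.
have lbY a b : (s * (s - 1) %| xn%:Z * Y a b)%Z.
  have := congr1 (mulmx Z) XY; rewrite mulmxA ZX mul_scalar_mx mul_mx_scalar.
  by move/matrixP/(_ a b); rewrite !mxE => ->; rewrite dvdz_mulr.
(* The upper left block of [Y] is [s R1^T - r1 J]. An entry 1 of [R1] gives [s - r1] at the
   transposed position, an entry -1 gives [- s - r1]; their difference is [2 s] and their sum
   [- 2 r1]. *)
have lb1 : (s * (s - 1) %| xn%:Z * (s - r1))%Z.
  have := lbY (lshift _ j) (lshift _ i).
  by rewrite YE block_mxEul !mxE Rij !mulr1.
have lb2 : (s * (s - 1) %| xn%:Z * (- s - r1))%Z.
  have := lbY (lshift _ j') (lshift _ i').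
  by rewrite YE block_mxEul !mxE Rij' mulr1 mulrN1.
have lbs : (s * (s - 1) %| xn%:Z * (2 * s))%Z.
  have -> : xn%:Z * (2 * s) = xn%:Z * (s - r1) - xn%:Z * (- s - r1) by ring.
  exact: rpredB.
have lbr1 : (s * (s - 1) %| xn%:Z * 2 * r1)%Z.
  have -> : xn%:Z * 2 * r1 = - (xn%:Z * (s - r1) + xn%:Z * (- s - r1)) by ring.
  by rewrite rpredN rpredD.
(* An entry of [R2] of either sign serves: its contribution is a multiple of [2 s], covered by
   [lbs]. *)
have lbr2 : (s * (s - 1) %| xn%:Z * 2 * r2)%Z.
  have H := lbY (lshift _ i) (rshift _ i).
  have -> : xn%:Z * 2 * r2 = 2 * (xn%:Z * (r2 - s * R2 i i)) + xn%:Z * (2 * s) * R2 i i.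
    by ring.
  apply: rpredD; [apply: dvdz_mull | exact: dvdz_mulr].
  by move: H; rewrite YE block_mxEur !mxE mulr1.
have lb : (s * (s - 1) %| xn%:Z * (2 * g))%Z.
  have -> : xn%:Z * (2 * g) = gcdz (xn%:Z * 2 * r1) (xn%:Z * 2 * r2).
    by rewrite -mulz_gcdr abszM mulrA.
  by rewrite dvdz_gcd lbr1 lbr2.
have absE : `|(xn%:Z * (2 * g))%R|%N = `|(s * (s - 1))%R|%N.
  by apply/eqP; rewrite eqn_dvd -!dvdzE ub lb.
have g0 : 0 <= g by [].
have s0 : 0 <= s * (s - 1) by rewrite mulr_ge0 ?subr_ge0 // (le_trans ler01).
have xg0 : 0 <= xn%:Z * (2 * g) by rewrite !mulr_ge0.
by rewrite -[LHS]gez0_abs // absE gez0_abs.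
Qed.

(** * Arithmetic of the invariant factors *)

(** Here [g] stands for the gcd of [r1] and [r2]. Indices start at 0, so [4 * t + 1] is the last one
    and [4 * t] the next to last. *)
Lemma invariant_factors_shape (t p g : nat) (x : seq nat) :
    (0 < t)%N -> prime p -> (4 * t + 1 = p ^ 2)%N ->
    size x = (4 * t + 2)%N -> sorted dvdn x -> nth 0%N x 0 = 1%N ->
    (forall i, 0 < i < 4 * t + 2 -> 2 %| nth 0 x i)%N ->
    (\prod_(i < 4 * t + 2) nth 0 x i = 2 * (4 * t) ^ (2 * t) * p ^ 2)%N ->
    (nth 0 x (4 * t + 1) * g = 2 * t * p ^ 2)%N -> (g = 1 \/ g = p)%N ->
  [/\ g = 1%N -> (nth 0 x (4 * t) %| 2 * t)%N,
      g = p -> (nth 0 x (4 * t) %| 2 * t * p)%N /\ (p %| nth 0 x (4 * t))%N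
    & squarefree t ->
      x = [:: 1%N] ++ nseq (2 * t + 1) 2%N ++ nseq (2 * t - 1) (2 * t)%N
           ++ [:: (2 * t * (4 * t + 1))%N] \/
      x = [:: 1%N] ++ nseq (2 * t + 1) 2%N ++ nseq (2 * t - 2) (2 * t)%N
           ++ [:: (2 * t * p)%N; (2 * t * p)%N]].
Proof.
move=> t0 p_pr tp sx dx x0 xeven prodx lastx gE.
set f := nth 0%N x in x0 xeven prodx lastx *.
have p0 := prime_gt0 p_pr; have p1 := prime_gt1 p_pr.
have t1 : (1 < t)%N by have : p != 2%N by [apply/eqP => p2; rewrite p2 in tp; lia]; nia.
have cop_p4t : coprime p (4 * t).
  rewrite prime_coprime //; apply/negP => p4t.
  have : (p %| 4 * t + 1)%N by rewrite tp dvdn_mulr.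
  by rewrite dvdn_addr // dvdn1; move: p1; case: eqP => // ->.
have cop_pt : coprime p t by rewrite (coprime_dvdr _ cop_p4t) // dvdn_mull.
have cop_p2 : coprime p 2 by rewrite (coprime_dvdr _ cop_p4t) // dvdn_mulr.
have cop_p2t : coprime p (2 * t) by rewrite coprimeMr cop_p2.
have fmono i j : (i <= j < 4 * t + 2)%N -> (f i %| f j)%N.
  by rewrite -sx; apply: sorted_dvdn_nth.
(* [Q] is the product of all factors but the last two; a prime [p] dividing it divides one of them,
   hence also the later ones. *)
have [Q fQ] : exists Q, [/\ (Q * f (4 * t) * f (4 * t + 1) = 2 * (4 * t) ^ (2 * t) * p ^ 2)%N,
    (forall i, i < 4 * t -> f i %| Q)%N & (p %| Q -> p %| f (4 * t))%N].
  exists (\prod_(i < 4 * t) f i)%N; split.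
  - by rewrite -prodx addn2 !big_ord_recr /= addn1.
  - by move=> i it; rewrite (bigD1 (Ordinal it)) //= dvdn_mulr.
  - elim/big_ind: _ => [|a b IHa IHb|i _].
    + by rewrite dvdn1 => /eqP E; move: p1; rewrite E.
    + by rewrite Euclid_dvdM // => /orP[/IHa|/IHb].
    + by move/dvdn_trans; apply; apply: fmono; have := ltn_ord i; lia.
case: fQ => QE fQ pQ.
have pN3 : ~ (p ^ 3 %| 2 * (4 * t) ^ (2 * t) * p ^ 2)%N.
  rewrite expnS dvdn_pmul2r ?expn_gt0 ?p0 // => pN.
  have : coprime p (2 * (4 * t) ^ (2 * t)) by rewrite coprimeMr cop_p2 coprimeXr.
  by rewrite prime_coprime // pN.
have g1_case : g = 1%N -> f (4 * t + 1)%N = (2 * t * p ^ 2)%N /\ ~~ (p %| f (4 * t))%N.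
  move=> g1; have lE : f (4 * t + 1)%N = (2 * t * p ^ 2)%N by rewrite -lastx g1 muln1.
  split=> //; apply/negP => pf; apply: pN3; rewrite -QE lE expnS.
  by rewrite dvdn_mul // dvdn_mull.
(* The last factor takes a single [p]. The other one divides [Q * f (4 * t)], and if it divides [Q]
   it passes to [f (4 * t)] along the chain. *)
have gp_case : g = p -> f (4 * t + 1)%N = (2 * t * p)%N /\ (p %| f (4 * t))%N.
  move=> gp; have lE : f (4 * t + 1)%N = (2 * t * p)%N.
    by apply/eqP; rewrite -(eqn_pmul2r p0) -mulnA -lastx gp.
  split=> //; have : (p * p %| Q * f (4 * t) * (2 * t) * p)%N.
    by rewrite -mulnA -lE QE dvdn_mull.
  by rewrite dvdn_pmul2r // Gauss_dvdl // Euclid_dvdM // => /orP[/pQ|].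
(* Otherwise [p] would divide at least three factors, against [pN3]. *)
have pNf i : (i < 4 * t)%N -> ~~ (p %| f i)%N.
  move=> it; apply/negP => pf.
  have pf4 : (p %| f (4 * t))%N by rewrite (dvdn_trans pf) // fmono; lia.
  case: gE => [/g1_case[_]|/gp_case[lE _]]; first by rewrite pf4.
  apply: pN3; rewrite -QE lE !expnS expn0 muln1 mulnA.
  apply: dvdn_mul; last exact: dvdn_mull.
  by apply: dvdn_mul => //; apply: dvdn_trans pf (fQ _ it).
clear Q QE fQ pQ pN3.
have f_last i : (i < 4 * t + 2)%N -> (f i %| 2 * t * p ^ 2)%N.
  by move=> it; rewrite -lastx dvdn_mulr // fmono //; lia.
clear lastx.
have g1_last : g = 1%N -> f (4 * t + 1)%N = (2 * t * (4 * t + 1))%N.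
  by move/g1_case => [-> _]; rewrite tp.
clear tp.
have f4t : g = 1%N -> (f (4 * t)%N %| 2 * t)%N.
  move=> /g1_case[_ pf]; have := f_last (4 * t)%N; rewrite Gauss_dvdl; first by apply; lia.
  by rewrite coprimeXr // coprime_sym prime_coprime.
split=> // [/gp_case[lE pf]|sqf].
  by split=> //; rewrite -lE fmono //; lia.
(* Halves of the even factors; the shift by one drops the leading 1. *)
pose z i := (f i.+1 %/ 2)%N.
have fz i : (i < 4 * t + 1)%N -> f i.+1 = (2 * z i)%N.
  by move=> it; rewrite mulnC divnK // xeven //; lia.
have zd i : (i < 4 * t + 1)%N -> (z i %| t * p ^ 2)%N.
  by move=> it; rewrite -(@dvdn_pmul2l 2) // -fz // mulnA f_last //; lia.
have zprod : (\prod_(i < 4 * t + 1) z i = t ^ (2 * t) * p ^ 2)%N.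
  apply/eqP; rewrite -(@eqn_pmul2l (2 ^ (4 * t + 1))) ?expn_gt0 //; apply/eqP.
  have -> : (2 ^ (4 * t + 1) * (t ^ (2 * t) * p ^ 2) = 2 * (4 * t) ^ (2 * t) * p ^ 2)%N.
    by rewrite expnMn (_ : 4 = 2 ^ 2)%N // -expnM mulnA addn1 expnS !mulnA.
  rewrite -prodx (addnS _ 1) big_ord_recl x0 mul1n.
  have -> : (2 ^ (4 * t + 1) = \prod_(i < 4 * t + 1) 2)%N by rewrite prod_nat_const card_ord.
  by rewrite -big_split /=; apply: eq_bigr => i _; rewrite -fz.
clear prodx.
(* The power [t ^ (2 * t)] in [zprod] puts [t] into the last [2 * t] of the [4 * t + 1] halves. *)
have split_z : {in gtn (4 * t + 1), forall i,
    if (2 * t + 1 <= i)%N then (t %| z i)%N else coprime (z i) t}.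
  have -> : (2 * t + 1 = 4 * t + 1 - 2 * t)%N by clear; lia.
  apply: (dvdn_chain_split (c := (p ^ 2)%N)) => //.
  - by rewrite coprimeXl.
  - move=> i j im jm ij; rewrite -(@dvdn_pmul2l 2) // -!fz // fmono //.
    by move: jm ij; rewrite inE /=; lia.
  - by rewrite expn_gt0 p0.
clear zprod.
have cop_zp i : (i.+1 < 4 * t)%N -> coprime (z i) (p ^ 2).
  move=> it; rewrite coprimeXr // coprime_sym prime_coprime //.
  by apply: contra (pNf _ it) => pz; rewrite fz ?dvdn_mull //; lia.
(* Such a half divides [t * p ^ 2] and is coprime to both [t] and [p], so it is 1. *)
have f_lo i : (0 < i <= 2 * t + 1)%N -> f i = 2%N.
  case: i => // i /= it; rewrite fz; last lia.
  have im : (i < 4 * t + 1)%N by lia.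
  have := split_z i im; rewrite leqNgt it /= => czt.
  have := zd i im; rewrite Gauss_dvdr // => zp.
  have /eqP : coprime (z i) (p ^ 2) by apply: cop_zp; lia.
  by move/gcdn_idPl: zp => -> ->.
have f_mid i : (2 * t + 1 < i < 4 * t)%N -> f i = (2 * t)%N.
  case: i => // i /andP[it i4]; rewrite fz; last lia.
  have im : (i < 4 * t + 1)%N by lia.
  have := split_z i im; rewrite -ltnS it => tz.
  congr (_ * _)%N; apply/eqP; rewrite eqn_dvd tz andbT.
  by have := zd i im; rewrite Gauss_dvdl // cop_zp.
have t_pen : (2 * t %| f (4 * t))%N.
  have im : (4 * t - 1 < 4 * t + 1)%N by clear; lia.
  have := split_z _ im; case: ifP => [_ tz|]; last by clear - t1; lia.
  have -> : (4 * t = (4 * t - 1).+1)%N by clear - t1; lia.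
  by rewrite fz // dvdn_pmul2l.
case: gE => [g1|gp]; [left | right].
- have lE := g1_last g1.
  have pE : f (4 * t)%N = (2 * t)%N by apply/eqP; rewrite eqn_dvd t_pen f4t.
  apply: (@eq_from_nth _ 0%N) => [|i].
    by rewrite /= !size_cat !size_nseq sx /=; clear - t1; lia.
  rewrite sx -/f => it; case: i it => [|i] it //=.
  rewrite !nth_cat !nth_nseq !size_nseq.
  case: ltnP => i1; first by rewrite f_lo.
  case: ltnP => i2; last first.
    have -> : i = (4 * t)%N by clear - t1 i1 i2 it; lia.
    have -> : (4 * t - (2 * t + 1) - (2 * t - 1) = 0)%N by clear - t1; lia.
    by rewrite -addn1 lE.
  (* The run of [2 * t] ends at index [4 * t], which [f_mid] does not reach; [pE] covers it. *)
  have [->|ne] := eqVneq i.+1 (4 * t)%N; first by [].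
  by rewrite f_mid //; clear - i1 i2 it ne; lia.
- have [lE pf] := gp_case gp.
  have pE : f (4 * t)%N = (2 * t * p)%N.
    apply/eqP; rewrite eqn_dvd Gauss_dvd 1?coprime_sym // t_pen pf !andbT -lE.
    by apply: fmono; clear; lia.
  apply: (@eq_from_nth _ 0%N) => [|i].
    by rewrite /= !size_cat !size_nseq sx /=; clear - t1; lia.
  rewrite sx -/f => it; case: i it => [|i] it //=.
  rewrite !nth_cat !nth_nseq !size_nseq.
  case: ltnP => i1; first by rewrite f_lo.
  case: ltnP => i2; first by rewrite f_mid //; clear - i1 i2 it; lia.
  have [i4|i4] : i.+1 = (4 * t)%N \/ i.+1 = (4 * t + 1)%N by clear - t1 i1 i2 it; lia.
    by rewrite i4 pE; have -> : (i - (2 * t + 1) - (2 * t - 2) = 0)%N by clear - t1 i4; lia.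
  by rewrite i4 lE; have -> : (i - (2 * t + 1) - (2 * t - 2) = 1)%N by clear - t1 i4; lia.
Qed.

Theorem theorem7p1 (t p : nat) (R1 R2 : 'M[int]_(2 * t + 1)) (r1 r2 : int)
    (x : seq nat)
    (J := allones (2 * t + 1))
    (X := block_mx R1 R2 (- R2^T) R1^T) :
  (0 < t)%N -> prime p -> (4 * t + 1 = p ^ 2)%N ->
  EW_matrix X ->
  R1 *m J = r1 *: J -> R1^T *m J = r1 *: J ->
  R2 *m J = r2 *: J -> R2^T *m J = r2 *: J ->
  smith_normal_form X x ->
  let x_last := nth 0%N x (4 * t + 1) in
  let x_penult := nth 0%N x (4 * t) in
  [/\ gcdz r1 r2 = 1 \/ gcdz r1 r2 = p%:Z,
      x_last = (2 * t * (4 * t + 1))%N \/ x_last = (2 * t * p)%N,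
      (x_last = (2 * t * (4 * t + 1))%N -> (x_penult %| 2 * t)%N) /\
      (x_last = (2 * t * p)%N -> (x_penult %| 2 * t * p)%N /\ (p %| x_penult)%N)
    & squarefree t ->
      smith_normal_form X
        ([:: 1%N] ++ nseq (2 * t + 1) 2%N ++ nseq (2 * t - 1) (2 * t)%N
           ++ [:: (2 * t * (4 * t + 1))%N]) \/
      smith_normal_form X
        ([:: 1%N] ++ nseq (2 * t + 1) 2%N ++ nseq (2 * t - 2) (2 * t)%N
           ++ [:: (2 * t * p)%N; (2 * t * p)%N])].
Proof.
move=> t0 p_pr tp ewX R1J R1TJ R2J R2TJ snf /=.
have hE : (2 * t + 1 + (2 * t + 1) = 4 * t + 2)%N by clear; lia.
have pp : p%:Z ^+ 2 = (4 * t + 1)%N%:Z by rewrite tp.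
have sE : (2 * t + 1 + (2 * t + 1))%N%:Z - 1 = p%:Z ^+ 2.
  by rewrite hE pp; clear; lia.
have h0 : (0 < 2 * t + 1)%N by rewrite addn1.
(* For [t = 1] the number [4 * t + 1 = 5] is not a square. *)
have h3 : (3 < 2 * t + 1)%N.
  have : t != 1%N; last by move: t0; clear; lia.
  by apply/eqP => t1; move: tp; rewrite t1; case: (p) => [|[|[|q]]] //; clear; nia.
have hodd : odd (2 * t + 1) by clear; lia.
have [sx dx _] := snf; rewrite hE in sx.
have r1odd := odd_row_sum _ _ _ hodd (EW_R1_entry _ _ _ ewX) R1J.
have sq := EW_sum_squares _ _ _ _ _ h0 ewX R1J R1TJ R2J R2TJ.
rewrite sE in sq.
have gP := gcdz_sum_squares _ _ _ p_pr r1odd sq.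
(* [EW_det] reads [|det X| * 4 t = 2 p ^ 2 (4 t) ^ (2 t + 1)]; one factor [4 t] cancels. *)
have prodx : (\prod_(i < 4 * t + 2) nth 0 x i = 2 * (4 * t) ^ (2 * t) * p ^ 2)%N.
  have := EW_det _ _ _ h0 ewX; rewrite sE (smith_det _ _ _ snf) hE.
  have -> : `|(p%:Z ^+ 2 - 1)%R|%N = (4 * t)%N by rewrite pp; clear; lia.
  rewrite abszX addn1 (expnSr (4 * t)) mulnA => /eqP.
  rewrite eqn_pmul2r ?muln_gt0 // => /eqP ->; exact: mulnAC.
have p0 := prime_gt0 p_pr.
have xpos i : (i < 2 * t + 1 + (2 * t + 1))%N -> (0 < nth 0 x i)%N.
  rewrite hE => it; apply: (@dvdn_gt0 _ (\prod_(i < 4 * t + 2) nth 0 x i)%N).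
    by rewrite prodx !muln_gt0 !expn_gt0 p0 muln_gt0 t0.
  by rewrite (bigD1 (Ordinal it)) //= dvdn_mulr.
have gs : (gcdz r1 r2 %| p%:Z ^+ 2)%Z by case: gP => ->; [exact: dvd1z | exact: dvdz_mulr].
have last_eq : (nth 0 x (4 * t + 1) * `|gcdz r1 r2| = 2 * t * p ^ 2)%N.
  have := EW_last_factor _ _ _ _ _ _ h3 hodd ewX R1J R1TJ R2J R2TJ.
  move/(_ x); rewrite sE => /(_ gs snf xpos); rewrite hE addn2 -addn1 /=.
  move/(congr1 absz); rewrite !abszM.
  have -> : `|(p%:Z ^+ 2 - 1)%R|%N = (4 * t)%N by rewrite pp; clear; lia.
  rewrite -[(p ^ 2)%N]/(p * p)%N !absz_nat.
  move: (nth _ _ _) (gcdn _ _) (p * p)%N => a b c; clear; nia.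
have Xodd i j : ~~ (2 %| X i j)%Z by case: (EW_entry _ _ _ ewX i j) => ->.
have n0 : (0 < 2 * t + 1 + (2 * t + 1))%N by rewrite hE addn2.
(* The first factor divides every entry, and the entries are 1 or -1. *)
have x0 : nth 0%N x 0 = 1%N.
  pose i0 := Ordinal n0; have := smith_first_dvd _ _ _ snf i0 i0 n0.
  by case: (EW_entry _ _ _ ewX i0 i0) => ->; rewrite dvdzE ?abszN dvdn1 => /eqP.
have xeven i : (0 < i < 4 * t + 2)%N -> (2 %| nth 0 x i)%N.
  by rewrite -hE => it; have := smith_even _ _ _ snf i it Xodd; rewrite x0 mul1n.
have gP' : `|gcdz r1 r2|%N = 1%N \/ `|gcdz r1 r2|%N = p by case: gP => ->; [left | right].
have [H1 Hp H4] := invariant_factors_shape _ _ _ _ t0 p_pr tp sx dx x0 xeven prodx last_eq gP'.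
(* The two possible last factors differ, so the last factor determines the gcd, as part (iii)
   requires. *)
have N1 : (2 * t * p != 2 * t * (4 * t + 1))%N.
  by rewrite tp eqn_pmul2l ?muln_gt0 // neq_ltn expnS expn1 ltn_Pmulr ?prime_gt1 //.
have lastP : nth 0%N x (4 * t + 1) = (2 * t * (4 * t + 1))%N /\ `|gcdz r1 r2|%N = 1%N \/
    nth 0%N x (4 * t + 1) = (2 * t * p)%N /\ `|gcdz r1 r2|%N = p.
  case: gP' => gE; rewrite gE in last_eq; [left | right]; split=> //.
    by rewrite -[LHS]muln1 last_eq tp.
  by apply/eqP; rewrite -(eqn_pmul2r p0) last_eq -!mulnA.
split=> //.
- by case: lastP => [[-> _]|[-> _]]; [left | right].
- split=> lE.
    by case: lastP => [[_ /H1]|[lE' _]] //; move: N1; rewrite -lE -lE' eqxx.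
  by case: lastP => [[lE' _]|[_ /Hp]] //; move: N1; rewrite -lE -lE' eqxx.
- by move=> /H4[] xE; [left | right]; rewrite xE in snf.
Qed.
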